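(* Let $X$ be a real Banach space and let $f:\mathbb{R}\to X$ be an arbitrary mapping. Then the set of points $x\in\mathbb{R}$ where either $mD_-(f,x)>mD^+(f,x)$ or $mD_+(f,x)>mD^-(f,x)$ is countable.
   Context: For $f:\mathbb{R}\to X$ and $x\in\mathbb{R}$, the unilateral upper and lower metric derived numbers are $mD^{\pm}(f,x)=\limsup_{t\to0+}\frac{\|f(x\pm t)-f(x)\|}{t}$ and $mD_{\pm}(f,x)=\liminf_{t\to0+}\frac{\|f(x\pm t)-f(x)\|}{t}$, with values in $[0,+\infty]$ (the value $+\infty$ is allowed). ''Countable'' means finite or countably infinite. *)

(* Defs.v *)
From mathcomp Require Import all_boot all_order all_algebra.
From mathcomp Require Import all_classical all_reals all_analysis.

Set Implicit Arguments.
Unset Strict Implicit.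
Unset Printing Implicit Defensive.

Import Order.TTheory GRing.Theory Num.Theory.
Import numFieldNormedType.Exports.

Local Open Scope classical_set_scope.
Local Open Scope ring_scope.

Section metric_derived_numbers.
Context {R : realType} {X : normedModType R}.
Implicit Types (f : R -> X) (x : R).

(* In the names, upper/lower stands for limsup/liminf (the position of the
   sign in mD^± / mD_±) and right/left for the sign + / -. *)

Definition mD_upper_right f x : \bar R :=
  limf_esup (fun t : R => (`|f (x + t) - f x| / t)%:E) (0 : R)^'+.

Definition mD_upper_left f x : \bar R :=
  limf_esup (fun t : R => (`|f (x - t) - f x| / t)%:E) (0 : R)^'+.

Definition mD_lower_right f x : \bar R :=
  limf_einf (fun t : R => (`|f (x + t) - f x| / t)%:E) (0 : R)^'+.

Definition mD_lower_left f x : \bar R :=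
  limf_einf (fun t : R => (`|f (x - t) - f x| / t)%:E) (0 : R)^'+.

End metric_derived_numbers.

(* Main.v *)
(* Both inequalities are covered by a fact about an arbitrary function [F] of two
   reals: [limsup_(t -> 0+) F x (x + t) < liminf_(t -> 0+) F (x - t) x] holds for
   countably many [x].  Separate the two limits by a rational [q]; then, for some
   [n] and all [0 < t < 1/n], we have [F x (x + t) < q] and not [F (x - t) x < q].
   Two points [x < y] sharing [q] and [n] are at distance at least [1/n], for
   otherwise [F x y < q] as seen from [x] but not as seen from [y].  One inequality
   is the case where [F x y] is the norm of the difference quotient of [f]; the
   other one is the case of its opposite, which exchanges the two sides. *)
Require Import Defs.
From mathcomp Require Import all_boot all_order all_algebra.
From mathcomp Require Import all_classical all_reals all_analysis.

Import Order.TTheory GRing.Theory Num.Theory.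
Import numFieldNormedType.Exports.

Local Open Scope classical_set_scope.
Local Open Scope ring_scope.

Lemma countableU {T : Type} (A B : set T) :
  countable A -> countable B -> countable (A `|` B).
Proof.
by move=> cA cB; rewrite -bigcup2E; apply: bigcup_countable => // -[|[|n]] _ /=.
Qed.

Lemma lte_rat_between {R : realType} {a b : \bar R} :
  (a < b)%E -> exists q : rat, (a < (ratr q)%:E < b)%E.
Proof.
have real_between (x y : R) (xy : x < y) : exists q : rat, x < ratr q < y.
  by have [q] := rat_in_itvoo xy; rewrite in_itv /=; exists q.
case: a b => [x| |] [y| |] //= ab.
- by have [q xqy] := real_between _ _ ab; exists q; rewrite !lte_fin.
- have [|q /andP[xq _]] := real_between x (x + 1); first by rewrite ltrDl.
  by exists q; rewrite lte_fin xq ltry.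
- have [|q /andP[_ qy]] := real_between (y - 1) y; first by rewrite gtrBl.
  by exists q; rewrite lte_fin qy ltNyr.
- by exists 0; rewrite ltNyr ltry.
Qed.

Section near_limf.
Context {T : choiceType} {X : filteredType T} {R : realType}.
Context {f : X -> \bar R} {F : set_system X} {FF : Filter F}.
Local Open Scope ereal_scope.

Lemma limf_esup_lt_near {a : \bar R} :
  limf_esup f F < a -> \forall x \near F, f x < a.
Proof.
move=> /ereal_inf_lt[_ [V FV <-] supVa]; apply: filterS FV => x Vx.
by apply: le_lt_trans supVa; apply: ereal_sup_ubound; exists x.
Qed.

Lemma limf_einf_gt_near {a : \bar R} :
  a < limf_einf f F -> \forall x \near F, a < f x.
Proof.
rewrite limf_einfE => /ereal_sup_gt[_ [V FV <-] ainfV].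
apply: filterS FV => x Vx.
by apply: lt_le_trans ainfV _; apply: ereal_inf_lbound; exists x.
Qed.

End near_limf.

Lemma near_right0_natSinv {R : archiRealFieldType} {P : set R} :
  (\forall t \near 0^'+, P t) ->
  exists n : nat, forall t, 0 < t < n.+1%:R^-1 -> P t.
Proof.
move=> [_/posnumP[e] eP].
have [n ne] := filter_ex (near_infty_natSinv_lt e).
exists n => t /andP[t0 tn]; apply: eP => //=.
by rewrite sub0r normrN gtr0_norm// (lt_trans tn).
Qed.

Lemma countable_separated {R : realType} (A : set R) (e : R) : 0 < e ->
  (forall x y, A x -> A y -> x < y -> e <= y - x) -> countable A.
Proof.
move=> e0 Asep.
suff Aisolated : A `<=` isolated A.
  exact: sub_countable (subset_card_le Aisolated) (countable_isolated A).
move=> x Ax; split; first exact/mem_set.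
exists (ball x e); first exact: nbhsx_ballx.
apply/seteqP; split=> [y [xey Ay]|_ ->]; last by split; first exact: ballxx.
move: xey; rewrite /ball/=; have [xy|yx|//] := ltgtP x y.
- by rewrite distrC gtr0_norm ?subr_gt0// ltNge Asep.
- by rewrite gtr0_norm ?subr_gt0// ltNge Asep.
Qed.

Lemma countable_near_right_near_leftN {R : realType} (P : R -> R -> Prop) :
  countable [set x | \forall t \near 0^'+, P x (x + t) /\ ~ P (x - t) x].
Proof.
pose A n := [set x | forall t, 0 < t < n.+1%:R^-1 ->
  P x (x + t) /\ ~ P (x - t) x].
apply: (sub_countable (B := \bigcup_n A n)).
  by apply: subset_card_le => x /near_right0_natSinv[n Anx]; exists n.
apply: bigcup_countable => // n _.
apply: (countable_separated _ n.+1%:R^-1) => [|x y Ax Ay xy].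
  by rewrite invr_gt0.
rewrite leNgt; apply/negP => yxn.
have yx_itv : 0 < y - x < n.+1%:R^-1 by rewrite subr_gt0 xy.
have [+ _] := Ax _ yx_itv; have [_] := Ay _ yx_itv.
by rewrite subrKC subKr.
Qed.

Lemma countable_limsup_right_lt_liminf_left {R : realType}
    (F : R -> R -> \bar R) :
  countable [set x | limf_esup (fun t => F x (x + t)%R) 0^'+ <
                     limf_einf (fun t => F (x - t)%R x) 0^'+]%E.
Proof.
pose A (q : rat) := [set x | \forall t \near 0^'+,
  (F x (x + t)%R < (ratr q)%:E)%E /\ ~ (F (x - t)%R x < (ratr q)%:E)%E].
apply: (sub_countable (B := \bigcup_q A q)); last first.
  apply: bigcup_countable => // q _.
  exact: (countable_near_right_near_leftN (fun x y => F x y < (ratr q)%:E)%E).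
apply: subset_card_le => x /lte_rat_between[q /andP[sup_q q_inf]].
exists q => //.
apply: filterS2 (limf_esup_lt_near sup_q) (limf_einf_gt_near q_inf) => t Fq qF.
by split=> //; apply/negP; rewrite -leNgt ltW.
Qed.

Lemma countable_limsup_left_lt_liminf_right {R : realType}
    (F : R -> R -> \bar R) :
  countable [set x | limf_esup (fun t => F (x - t)%R x) 0^'+ <
                     limf_einf (fun t => F x (x + t)%R) 0^'+]%E.
Proof.
have := countable_limsup_right_lt_liminf_left (fun x y => - F x y)%E.
by under eq_set do rewrite limf_esupN limf_einfN lteN2.
Qed.

Theorem theorem3p2 (R : realType) (X : completeNormedModType R) (f : R -> X) :
  countable [set x : R |
    (mD_lower_left f x > mD_upper_right f x)%E \/
    (mD_lower_right f x > mD_upper_left f x)%E].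
Proof.
pose slope x y := (`|f y - f x| / (y - x))%:E.
have slope_right x : (fun t => slope x (x + t)) =
    (fun t => (`|f (x + t) - f x| / t)%:E).
  by apply/funext => t; rewrite /slope -addrA subrKC.
have slope_left x : (fun t => slope (x - t) x) =
    (fun t => (`|f (x - t) - f x| / t)%:E).
  by apply/funext => t; rewrite /slope distrC subKr.
apply: countableU.
- have := countable_limsup_right_lt_liminf_left slope.
  by under eq_set do rewrite slope_right slope_left.
- have := countable_limsup_left_lt_liminf_right slope.
  by under eq_set do rewrite slope_right slope_left.
Qed.
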